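(* There is no isometric immersion of a compact Kaehler manifold $M^{2n}$ of real dimension $2n$ into $\mathbb{H}^{2n+p}$ if $n\geq 3$ and $p\leq n-2$.
   Context: $\mathbb{H}^{N}$ denotes the $N$-dimensional hyperbolic space of constant sectional curvature $-1$. Compact manifolds are without boundary. Isometric immersions are isometric only for the Riemannian metrics. *)

(* Defs.v *)
From HB Require Import structures.
From mathcomp Require Import all_boot all_order all_algebra.
From mathcomp Require Import all_classical all_reals all_analysis.
Import Order.TTheory GRing.Theory Num.Theory.
Import numFieldNormedType.Exports.

Set Implicit Arguments.
Unset Strict Implicit.
Unset Printing Implicit Defensive.

Local Open Scope classical_set_scope.
Local Open Scope ring_scope.

(* [iter_derive f [:: v1; ...; vk]] is D_v1 ... D_vk f. *)
Definition iter_derive (R : realType) (V W : normedModType R)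
    (f : V -> W) (s : seq V) : V -> W :=
  foldr (fun v (g : V -> W) => 'D_v g) f s.

(* C^infinity on an open set [U]: all iterated directional derivatives are
   differentiable (hence continuous) at every point of [U]. *)
Definition smooth_on (R : realType) (V W : normedModType R)
    (U : set V) (f : V -> W) : Prop :=
  forall (s : seq V) (x : V), U x -> differentiable (iter_derive f s) x.

(* C^n is modelled on R^(n + n), the point x + iy being [row_mx x y]; thus
   [mul_i] sends (x, y) to (- y, x). *)
Definition mul_i (R : realType) (n : nat) (v : 'rV[R]_(n + n)) :
    'rV[R]_(n + n) :=
  row_mx (- rsubmx v) (lsubmx v).

(* On an open set, a map is holomorphic iff it is smooth with complex-linear
   differential (the Cauchy-Riemann equations). *)
Definition holomorphic_on (R : realType) (m n : nat) (U : set 'rV[R]_(m + m))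
    (f : 'rV[R]_(m + m) -> 'rV[R]_(n + n)) : Prop :=
  smooth_on U f /\
  forall x u, U x -> 'D_(mul_i u) f x = mul_i ('D_u f x).

(* A homeomorphism [chart_map] from an open subset of [M] onto an open subset
   of R^m, with inverse [chart_inv]; the values of [chart_map] off [chart_dom]
   and of [chart_inv] off [chart_cod] (below) are irrelevant. *)
Record chart (R : realType) (M : topologicalType) (m : nat) := Chart {
  chart_dom : set M;
  chart_map : M -> 'rV[R]_m;
  chart_inv : 'rV[R]_m -> M;
  chart_dom_open : open chart_dom;
  chart_cod_open : open (chart_map @` chart_dom);
  chart_mapK : forall p, chart_dom p -> chart_inv (chart_map p) = p;
  chart_map_continuous : {within chart_dom, continuous chart_map};
  chart_inv_continuous :
    {within chart_map @` chart_dom, continuous chart_inv} }.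

Section ChartTheory.
Context (R : realType) (M : topologicalType) (m : nat).
Implicit Types c d : chart R M m.

Definition chart_cod c : set 'rV[R]_m := chart_map c @` chart_dom c.

Definition overlap c d : set 'rV[R]_m :=
  chart_map c @` (chart_dom c `&` chart_dom d).

Definition transition c d : 'rV[R]_m -> 'rV[R]_m :=
  chart_map d \o chart_inv c.

End ChartTheory.

(* Complex manifolds of complex dimension [n], given by a holomorphic atlas;
   connectedness is not required. *)
Record complexManifold (R : realType) (n : nat) := ComplexManifold {
  cmfd_space :> topologicalType;
  cmfd_hausdorff : hausdorff_space cmfd_space;
  cmfd_second_countable : @second_countable cmfd_space;
  cmfd_index : Type;
  cmfd_chart : cmfd_index -> chart R cmfd_space (n + n);
  cmfd_cover : forall p : cmfd_space,
    exists i, chart_dom (cmfd_chart i) p;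
  cmfd_holomorphic : forall i j,
    holomorphic_on (overlap (cmfd_chart i) (cmfd_chart j))
                   (transition (cmfd_chart i) (cmfd_chart j)) }.

Definition bilin (R : realType) (m : nat) (G : 'M[R]_m) (u v : 'rV[R]_m) : R :=
  (u *m G *m v^T) 0 0.

(* The Riemannian metric is the tensor whose Gram matrix at the point of
   coordinates [x] in the chart [i] is [kmetric i x].  The complex structure is
   [mul_i] in every chart, and the Kaehler form is
   omega(u, v) = g(mul_i u, v).  [kmetric_closed] is d omega = 0 evaluated on
   constant (hence commuting) vector fields. *)
Record kaehlerManifold (R : realType) (n : nat) := KaehlerManifold {
  kmfd_cmfd :> complexManifold R n;
  kmetric : cmfd_index kmfd_cmfd -> 'rV[R]_(n + n) -> 'M[R]_(n + n);
  kmetric_smooth : forall i,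
    smooth_on (chart_cod (cmfd_chart i)) (kmetric i);
  kmetric_sym : forall i x, chart_cod (cmfd_chart i) x ->
    forall u v, bilin (kmetric i x) u v = bilin (kmetric i x) v u;
  kmetric_pos : forall i x, chart_cod (cmfd_chart i) x ->
    forall u, u != 0 -> 0 < bilin (kmetric i x) u u;
  kmetric_compat : forall i j x,
    overlap (cmfd_chart i) (cmfd_chart j) x ->
    let tau := transition (cmfd_chart i) (cmfd_chart j) in
    forall u v, bilin (kmetric i x) u v =
      bilin (kmetric j (tau x)) ('D_u tau x) ('D_v tau x);
  kmetric_hermitian : forall i x, chart_cod (cmfd_chart i) x ->
    forall u v,
      bilin (kmetric i x) (mul_i u) (mul_i v) = bilin (kmetric i x) u v;
  kmetric_closed : forall i x, chart_cod (cmfd_chart i) x ->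
    let omega v w (y : 'rV[R]_(n + n)) : R :=
      bilin (kmetric i y) (mul_i v) w in
    forall u v w,
      'D_u (omega v w) x + 'D_v (omega w u) x + 'D_w (omega u v) x = 0 }.

(* The Lorentzian form - x_0 y_0 + x_1 y_1 + ... + x_N y_N. *)
Definition lorentz (R : realType) (N : nat) (x y : 'rV[R]_N.+1) : R :=
  - (x 0 0 * y 0 0) +
  \sum_(k < N) x 0 (lift ord0 k) * y 0 (lift ord0 k).

(* Hyperboloid model of the N-dimensional hyperbolic space of constant
   sectional curvature -1: its Riemannian metric is the restriction of
   [lorentz] to tangent vectors. *)
Definition hyperbolic_space (R : realType) (N : nat) : set 'rV[R]_N.+1 :=
  [set x | lorentz x x = -1 /\ 0 < x 0 0].
Arguments hyperbolic_space : clear implicits.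

(* As the hyperboloid is an embedded submanifold of R^(N+1), a map into it is
   smooth iff it is smooth as an R^(N+1)-valued map; likewise its differential
   is that of the R^(N+1)-valued map. *)
Definition isometric_immersion (R : realType) (n N : nat)
    (M : kaehlerManifold R n) (f : M -> 'rV[R]_N.+1) : Prop :=
  (forall p, hyperbolic_space R N (f p)) /\
  forall i : cmfd_index M,
    let F := f \o chart_inv (cmfd_chart i) in
    smooth_on (chart_cod (cmfd_chart i)) F /\
    forall x, chart_cod (cmfd_chart i) x ->
      (forall u, 'D_u F x = 0 -> u = 0) /\
      (forall u v, lorentz ('D_u F x) ('D_v F x) = bilin (kmetric i x) u v).

(* Main.v *)
Require Import Defs.
From HB Require Import structures.
From mathcomp Require Import all_boot all_order all_algebra.
From mathcomp Require Import lra ring zify.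
From mathcomp Require Import all_classical all_reals all_analysis.

(** Let [f] immerse [M] isometrically into the hyperboloid of the Lorentz space
    L of dimension [N.+1], where [N = 2 * n + p].  The theorem compares what
    happens at a highest point of [f] with what the Kaehler structure forces at
    every point.

    Write [F] for [f] read in a holomorphic chart and [J] for the complex
    structure.  The normal spaces of [F] in L have dimension [p + 1], and the
    second fundamental form of [F] with values in L is
    [alpha u v], the normal part of [D_u D_v F].  Closedness of the Kaehler form
    makes the Levi-Civita connection commute with [J]
    ([kaehler_christoffel]), that is, the tangent part of [D_u D_(J v) F] is [J]
    of the tangent part of [D_u D_v F].  Differentiating this relation once more
    and antisymmetrizing gives, without ever naming the curvature tensor, the
    combination of the Gauss equation with the [J]-invariance of the curvature
    ([derive2_gauss], [alpha_gauss]).  It says that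
    [beta u v = (alpha u v, alpha u (J v))] is flat for the difference of two
    copies of the Lorentz form ([kaehler_flat_formP]).

    For [x] such that [beta x] has maximal rank, Moore's argument
    ([maxrank_ker_sub_im], [flat_form_null]) shows that the vectors
    [beta y z] with [beta x z = 0] span a null subspace.  The rank of [beta x]
    is at most [2 * (p + 1)], which is smaller than [2 * n], so there is such a
    [z <> 0]; the kernel being [J]-invariant, the null relations between the
    values of [beta] on [z] and [J z] add up to the statement that
    [v = alpha z z + alpha (J z) (J z)] is lightlike
    ([kaehler_null_vector]).

    Let now [x] be a point of [M], which is compact, where the coordinate
    [F 0 0] along the time axis is maximal.  There the time axis is normal to
    [F], and the second derivative test gives [v 0 0 <= 0]: [v] points to the
    past, or vanishes.  A lightlike vector of this kind has nonnegative product
    with the future timelike vector [F x] ([past_null_lorentz_ge0]).  But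
    [lorentz (F x) (F x) = -1] differentiated twice says that this product is
    minus the sum of the squared lengths of [z] and [J z], a contradiction. *)

Set Implicit Arguments.
Unset Strict Implicit.
Unset Printing Implicit Defensive.
Import Order.TTheory GRing.Theory Num.Theory.
Import numFieldNormedType.Exports.

Local Open Scope classical_set_scope.
Local Open Scope ring_scope.

(** * Linear algebra *)

Lemma sym_linear (R : pzRingType) (T L : lmodType R) (h : T -> T -> L) :
  (forall u v, h u v = h v u) -> (forall v, linear (h^~ v)) ->
  forall u, linear (h u).
Proof. by move=> h_sym h_lin u k v w; rewrite !(h_sym u) h_lin. Qed.

Lemma linear_opp (R : pzRingType) (T L : lmodType R) (h : T -> L) :
  linear h -> forall v, h (- v) = - h v.
Proof.
move=> h_lin v; have h0 : h 0 = 0.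
  by have := h_lin (-1) 0 0; rewrite scaleN1r oppr0 addr0 scaleN1r addNr.
by have := h_lin (-1) v 0; rewrite h0 !scaleN1r !addr0.
Qed.

Lemma linear_mx (F : fieldType) m k (f : 'rV[F]_m -> 'rV[F]_k) :
  linear f -> exists A : 'M[F]_(m, k), forall u, u *m A = f u.
Proof.
move=> f_lin.
pose g : {linear 'rV[F]_m -> 'rV[F]_k} :=
  HB.pack f (GRing.isLinear.Build _ _ _ _ f f_lin).
by exists (lin1_mx g) => u; rewrite mul_rV_lin1.
Qed.

(** With [s = t^-1] the matrix is a multiple of [s%:M + E], so any nonzero [s]
    that is not a root of the characteristic polynomial of [- E] will do; such
    an [s] exists because the field is infinite. *)
Lemma ex_scaled_perturb_unit (F : numFieldType) r (E : 'M[F]_r) :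
  exists2 t : F, t != 0 & 1%:M + t *: E \in unitmx.
Proof.
have q0 : char_poly (- E) * 'X != 0.
  by rewrite mulf_neq0 ?polyX_eq0 // monic_neq0 // char_poly_monic.
have [s s_root] : exists s : F, ~~ root (char_poly (- E) * 'X) s.
  pose rs := [seq (i%:R : F) | i <- iota 0 (size (char_poly (- E) * 'X))].
  have uniq_rs : uniq rs.
    by rewrite map_inj_uniq ?iota_uniq //; apply/mulrIn/oner_neq0.
  have [all_roots|] := boolP (all (root (char_poly (- E) * 'X)) rs).
    by have := max_poly_roots q0 all_roots uniq_rs; rewrite size_map size_iota ltnn.
  by case/allPn => s _ ns; exists s.
have [s0 det_s] : s != 0 /\ s%:M + E \in unitmx.
  move: s_root; rewrite rootM negb_or rootX => /andP[s_eig s0]; split=> //.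
  rewrite -eigenvalue_root_char /eigenvalue negbK kermx_eq0 in s_eig.
  by rewrite -row_free_unit -[row_free _]negbK -[s%:M + E]opprK opprD addrC;
     rewrite /row_free mxrank_opp; rewrite negbK.
exists s^-1; first by rewrite invr_eq0.
have -> : 1%:M + s^-1 *: E = s^-1 *: (s%:M + E).
  by rewrite scalerDr scale_scalar_mx mulVf.
by rewrite unitmxZ // unitfE invr_eq0.
Qed.

(** Moore's observation: if the rank cannot grow along the line [A + t *: C],
    then [C] maps the kernel of [A] into the image of [A].  The vector
    [z *m C = t^-1 *: z *m (A + t *: C)] lies in the image of [A + t *: C] for
    all [t != 0].  If it were outside the image of [A], it would remain
    independent of the perturbed basis of that image for some [t != 0], and the
    rank of [A + t *: C] would exceed that of [A]. *)
Lemma maxrank_ker_sub_im (F : numFieldType) m k (A C : 'M[F]_(m, k))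
    (z : 'rV[F]_m) :
  (forall t, \rank (A + t *: C)%R <= \rank A)%N -> z *m A = 0 ->
  (z *m C <= A)%MS.
Proof.
move=> rk_max zA0; apply: contraT => zC_out.
(* [K *m A] is a basis of the image of [A], and [K *m (A + t *: C)] deforms it. *)
pose K := pinvmx (col_base A).
have KA : K *m A = row_base A.
  rewrite -[X in _ *m X]mulmx_base mulmxA mulVpmx ?mul1mx //.
  exact: col_base_full.
pose D := col_mx (row_base A) (z *m C).
have lt_rk : (\rank A < \rank D)%N.
  have := mxrank_leqif_sup (addsmxSl (row_base A) (z *m C)).
  move=> /ltn_leqif; rewrite addsmx_sub submx_refl !eq_row_base zC_out.
  by rewrite addsmxE => ->.
have D_free : row_free D.
  by rewrite /row_free eqn_leq rank_leq_row (leq_trans _ lt_rk) ?addn1.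
(* [D'] is a right inverse of the enlarged family [D], so that independence of
   the deformed family follows from invertibility of [1%:M + t *: Q]. *)
have [D' DD'] := row_freeP D_free.
pose Q := col_mx (K *m C *m D') (0 : 'M[F]_(1, _)).
have [t t0 unit_t] := ex_scaled_perturb_unit Q.
have : (\rank (1%:M + t *: Q)%R <= \rank (A + t *: C)%R)%N.
  have -> : 1%:M + t *: Q = col_mx K (t^-1 *: z) *m (A + t *: C) *m D'.
    rewrite mul_col_mx mulmxDr KA -DD' mulmxDr -!scalemxAl -!scalemxAr zA0 scaler0 add0r.
    rewrite scalerA mulVf // scale1r /Q.
    rewrite scale_col_mx scaler0 /D !mul_col_mx add_col_mx addr0.
    by rewrite mulmxDl -scalemxAl.
  by rewrite (leq_trans (mxrankM_maxl _ _)) // mxrankM_maxr.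
rewrite mxrank_unit // => /leq_trans /(_ (rk_max t)).
by rewrite addn1 ltnn.
Qed.

(** For a flat form, [beta y z] is orthogonal to the image of [beta x] as soon as
    [beta x z = 0].  When [beta x] has maximal rank, [beta y z] also belongs to
    that image by [maxrank_ker_sub_im], hence the values of [beta] on the kernel
    of [beta x] are orthogonal to each other. *)
Lemma flat_form_null (F : numFieldType) m k
    (beta : 'rV[F]_m -> 'rV[F]_m -> 'rV[F]_k) (ip : 'rV[F]_k -> 'rV[F]_k -> F) :
  (forall x, linear (beta x)) -> (forall y, linear (beta^~ y)) ->
  (forall w, ip 0 w = 0) ->
  (forall x y z t, ip (beta x y) (beta z t) = ip (beta x t) (beta z y)) ->
  exists x, forall y z y' z', beta x z = 0 -> beta x z' = 0 ->
    ip (beta y z) (beta y' z') = 0.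
Proof.
move=> lin_r lin_l ip0 flat.
have [B BE] := choice (fun x => linear_mx (lin_r x)).
have Blin x y t : B (x + t *: y) = B x + t *: B y.
  apply/row_matrixP => i; rewrite !rowE mulmxDr -scalemxAr !BE addrC lin_l.
  by rewrite addrC.
have [r /asboolP[x <-] rmax] : exists2 r, `[< exists x, \rank (B x) = r >] &
    forall r', `[< exists x, \rank (B x) = r' >] -> (r' <= r)%N.
  have ex_r : exists r, `[< exists x, \rank (B x) = r >].
    by exists (\rank (B 0)); apply/asboolP; exists 0.
  have ub_r r : `[< exists x, \rank (B x) = r >] -> (r <= m)%N.
    by case/asboolP => x <-; exact: rank_leq_row.
  by case: (ex_maxnP ex_r ub_r) => r ? ?; exists r.
exists x => y z y' z'; rewrite -!(BE x) => xz0 xz'0.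
have /submxP[t yz] : (z *m B y <= B x)%MS.
  apply: maxrank_ker_sub_im xz0 => t; apply: rmax.
  by apply/asboolP; exists (x + t *: y); rewrite Blin.
by rewrite -BE yz BE flat -BE xz'0 ip0.
Qed.

Lemma linear_ker_neq0 (F : fieldType) m k l (f : 'rV[F]_m -> 'rV[F]_k)
    (Q : 'M[F]_(k, l)) :
  linear f -> (forall y, f y *m Q = 0) -> (k < m + \rank Q)%N ->
  exists2 z, z != 0 & f z = 0.
Proof.
move=> /linear_mx[A AE] fQ lt_k.
have AQ : A *m Q = 0.
  by apply/row_matrixP => i; rewrite !rowE mulmxA AE fQ mulmx0.
have : kermx A != 0.
  rewrite kermx_eq0 /row_free neq_ltn; apply/orP; left.
  by rewrite -(ltn_add2r (\rank Q)) (leq_ltn_trans _ lt_k) // mulmx0_rank_max.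
by case/rowV0Pn => z /sub_kermxP zA z0; exists z; rewrite // -AE.
Qed.

(** * The complex structure and the Lorentz form *)

Section MulI.
Context (R : realType) (n : nat).
Implicit Types u v : 'rV[R]_(n + n).

Lemma mul_i_linear : linear (@mul_i R n).
Proof.
move=> k u v; rewrite /mul_i linearP [lsubmx _]linearP.
by rewrite opprD -scalerN scale_row_mx add_row_mx.
Qed.

Lemma mul_iK u : mul_i (mul_i u) = - u.
Proof.
by rewrite /mul_i row_mxKl row_mxKr -opp_row_mx hsubmxK.
Qed.

End MulI.

Section LorentzForm.
Context (R : realType) (N : nat).
Implicit Types x y z : 'rV[R]_N.+1.

Definition lorentz_mx : 'M[R]_N.+1 :=
  diag_mx (\row_k (if k == 0 then -1 else 1)).

Lemma lorentzE x y : lorentz x y = (x *m lorentz_mx *m y^T) 0 0.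
Proof.
rewrite mxE big_ord_recl /lorentz /lorentz_mx mul_mx_diag !mxE eqxx.
congr (_ + _); first by rewrite mulrN1 mulNr.
by apply: eq_bigr => k _; rewrite !mxE /= mulr1.
Qed.

Lemma lorentzC x y : lorentz x y = lorentz y x.
Proof.
rewrite /lorentz mulrC; congr (_ + _).
by apply: eq_bigr => k _; rewrite mulrC.
Qed.

Lemma lorentzDl x y z : lorentz (x + y) z = lorentz x z + lorentz y z.
Proof. by rewrite !lorentzE !mulmxDl mxE. Qed.

Lemma lorentzNl x z : lorentz (- x) z = - lorentz x z.
Proof. by rewrite !lorentzE !mulNmx mxE. Qed.

Lemma lorentzBl x y z : lorentz (x - y) z = lorentz x z - lorentz y z.
Proof. by rewrite lorentzDl lorentzNl. Qed.

Lemma lorentzDr x y z : lorentz z (x + y) = lorentz z x + lorentz z y.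
Proof. by rewrite lorentzC lorentzDl !(lorentzC z). Qed.

Lemma lorentzNr x z : lorentz z (- x) = - lorentz z x.
Proof. by rewrite lorentzC lorentzNl lorentzC. Qed.

Lemma lorentzBr x y z : lorentz z (x - y) = lorentz z x - lorentz z y.
Proof. by rewrite lorentzDr lorentzNr. Qed.

Lemma lorentz_sqrD x y :
  lorentz (x + y) (x + y) = lorentz x x + 2 * lorentz x y + lorentz y y.
Proof. by rewrite lorentzDl !lorentzDr (lorentzC y x); ring. Qed.

Lemma lorentz0l x : lorentz 0 x = 0.
Proof. by rewrite !lorentzE !mul0mx mxE. Qed.

(** Reversed Cauchy-Schwarz inequality in the limiting case where one vector is
    lightlike: the future timelike vectors pair nonnegatively with the closed
    past light cone. *)
Lemma past_null_lorentz_ge0 x y : lorentz x x = 0 -> x 0 0 <= 0 ->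
  lorentz y y = -1 -> 0 < y 0 0 -> 0 <= lorentz x y.
Proof.
rewrite /lorentz; set x0 := x 0 0; set y0 := y 0 0.
set XX := \sum_(k < N) _; set YY := \sum_(k < N) _; set XY := \sum_(k < N) _.
move=> xx x0_le yy y0_gt.
have cs s r : 0 <= s ^+ 2 * YY + 2 * (s * r) * XY + r ^+ 2 * XX.
  rewrite /XX /YY /XY !mulr_sumr -!big_split /=.
  apply: sumr_ge0 => k _; set a := x 0 _; set b := y 0 _.
  by rewrite (_ : _ + _ = (s * b + r * a) ^+ 2) ?sqr_ge0 //; ring.
rewrite leNgt; apply/negP => neg.
have {xx}EX : XX = x0 ^+ 2 by rewrite expr2; lra.
have {yy}EY : YY = y0 ^+ 2 - 1 by rewrite expr2; lra.
have lt_XY : XY < x0 * y0 by lra.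
have le0 : x0 * y0 <= 0 by nra.
have lt_sq : (x0 * y0) ^+ 2 < XY ^+ 2 by nra.
(* This choice would minimize the form in [s] if [YY] were [y0 ^+ 2] instead of
   [y0 ^+ 2 - 1]; it makes the value negative. *)
have := cs (- XY) (y0 ^+ 2); rewrite EX EY.
have y2 : 0 < y0 ^+ 2 by rewrite exprn_gt0.
have XY2 : 0 <= XY ^+ 2 by rewrite sqr_ge0.
have -> : (- XY) ^+ 2 * (y0 ^+ 2 - 1) + 2 * (- XY * y0 ^+ 2) * XY +
   (y0 ^+ 2) ^+ 2 * x0 ^+ 2 = y0 ^+ 2 * ((x0 * y0) ^+ 2 - XY ^+ 2) - XY ^+ 2.
  by ring.
nra.
Qed.

End LorentzForm.

(** * The algebraic contradiction at one point *)

Section TangentProjection.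
Context (R : realType) (m N : nat) (P : 'M[R]_(m, N.+1)).
Hypothesis P_pos : forall u : 'rV_m, u != 0 -> 0 < lorentz (u *m P) (u *m P).

Implicit Types (h : 'rV[R]_N.+1) (t w : 'rV[R]_m).

(** The rows of [P] span the tangent space, on which the form is positive
    definite.  [h *m pair_tangent] lists the products of [h] with these rows, so
    normal vectors are those annihilated by [pair_tangent]. *)
Definition pair_tangent : 'M[R]_(N.+1, m) := lorentz_mx R N *m P^T.

(** Coordinates, in the rows of [P], of the tangent part of a vector: the
    products with the tangent space are corrected by the inverse Gram matrix. *)
Definition tangent_coord : 'M[R]_(N.+1, m) :=
  pair_tangent *m invmx (P *m pair_tangent).

Lemma lorentz_tangentE h w : lorentz h (w *m P) = (h *m pair_tangent *m w^T) 0 0.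
Proof. by rewrite lorentzE trmx_mul !mulmxA. Qed.

Lemma gram_unit : P *m pair_tangent \in unitmx.
Proof.
rewrite -row_free_unit -kermx_eq0; apply/negPn/negP => /rowV0Pn[u].
move=> /sub_kermxP uG /P_pos; rewrite lorentz_tangentE -(mulmxA u P) uG mul0mx mxE.
by rewrite ltxx.
Qed.

Lemma normal_part_pair_tangent h :
  (h - h *m tangent_coord *m P) *m pair_tangent = 0.
Proof.
by rewrite mulmxBl -!mulmxA mulVmx ?gram_unit // mulmx1 subrr.
Qed.

Lemma lorentz_normal_part h w :
  lorentz (h - h *m tangent_coord *m P) (w *m P) = 0.
Proof. by rewrite lorentz_tangentE normal_part_pair_tangent mul0mx mxE. Qed.

Lemma lorentz_tangent_coord h w :
  lorentz (h *m tangent_coord *m P) (w *m P) = lorentz h (w *m P).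
Proof.
by apply/esym/eqP; rewrite -subr_eq0 -lorentzBl lorentz_normal_part.
Qed.

Lemma tangent_coordP h t :
  (forall w, lorentz h (w *m P) = lorentz (t *m P) (w *m P)) ->
  h *m tangent_coord = t.
Proof.
move=> ht; apply/eqP; rewrite -subr_eq0; apply: contraT => /P_pos.
rewrite {1}mulmxBl lorentzBl lorentz_tangent_coord -ht subrr.
by rewrite ltxx.
Qed.

(** Pairs of normal vectors are the kernel of this block matrix, so its rank
    measures the dimension of the space where the form
    [(alpha u v, alpha u (J v))] takes its values. *)
Lemma rank_block_pair_tangent :
  \rank (block_mx pair_tangent 0 0 pair_tangent) = (m + m)%N.
Proof.
apply/eqP; rewrite eqn_leq rank_leq_col /=.
have := mxrankM_maxr (block_mx P 0 0 P) (block_mx pair_tangent 0 0 pair_tangent).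
rewrite mulmx_block !mulmx0 !mul0mx !addr0 !add0r; apply: leq_trans.
rewrite mxrank_unit // unitmxE det_ublock unitrM.
by rewrite -unitmxE gram_unit.
Qed.

End TangentProjection.

(** The second order data of an immersion at one point: [u *m P] stands for
    [D_u F], [H u v] for [D_u D_v F], and [f] for the position [F]. *)
Section PointwiseObstruction.
Context (R : realType) (n N : nat).
Local Notation T := ('rV[R]_(n + n)).
Local Notation L := ('rV[R]_N.+1).
Context (P : 'M[R]_(n + n, N.+1)) (H : T -> T -> L) (f : L).
Local Notation J := (@mul_i R n).
Hypothesis P_pos : forall u : T, u != 0 -> 0 < lorentz (u *m P) (u *m P).
Hypothesis P_hermitian : forall u v,
  lorentz (J u *m P) (J v *m P) = lorentz (u *m P) (v *m P).
Hypothesis H_linear : forall u, linear (H u).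
Hypothesis H_sym : forall u v, H u v = H v u.
Hypothesis H_kaehler : forall u v w,
  lorentz (H u (J v)) (w *m P) = - lorentz (H u v) (J w *m P).
Hypothesis H_gauss : forall u v w z,
  lorentz (H u v) (H w z) - lorentz (H z v) (H w u) =
  lorentz (H u (J v)) (H (J w) z) - lorentz (H z (J v)) (H (J w) u).

Let tau u v : T := H u v *m tangent_coord P.
Let alpha u v : L := H u v - tau u v *m P.

Lemma P_skew u v :
  lorentz (J u *m P) (v *m P) = - lorentz (u *m P) (J v *m P).
Proof. by rewrite -[in RHS]P_hermitian mul_iK mulNmx lorentzNr opprK. Qed.

(** The Levi-Civita connection commutes with the complex structure: [tau] is the
    Christoffel symbol, since the tangent part of [D_u D_v F] is the covariant
    derivative. *)
Lemma tau_mul_i u v : tau u (J v) = J (tau u v).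
Proof.
apply: tangent_coordP => // w.
by rewrite H_kaehler P_skew lorentz_tangent_coord.
Qed.

Lemma alphaC u v : alpha u v = alpha v u.
Proof. by rewrite /alpha /tau H_sym. Qed.

Lemma lorentz_alpha u v w z : lorentz (alpha u v) (alpha w z) =
  lorentz (H u v) (H w z) - lorentz (tau u v *m P) (tau w z *m P).
Proof.
rewrite {2}/alpha lorentzBr lorentz_normal_part // subr0 /alpha lorentzBl.
by congr (_ - _); rewrite lorentzC -lorentz_tangent_coord // lorentzC.
Qed.

(** The tangent parts cancel from [H_gauss] because [J] is an isometry and
    commutes with [tau]; what remains is the Gauss equation for a curvature
    tensor invariant under [J]. *)
Lemma alpha_gauss u v w z :
  lorentz (alpha u v) (alpha w z) - lorentz (alpha z v) (alpha w u) =
  lorentz (alpha u (J v)) (alpha (J w) z) -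
  lorentz (alpha z (J v)) (alpha (J w) u).
Proof.
have tauJ a b c d : lorentz (tau a (J b) *m P) (tau (J c) d *m P) =
    lorentz (tau a b *m P) (tau c d *m P).
  by rewrite [tau (J c) d]/tau H_sym -/(tau d (J c)) !tau_mul_i P_hermitian
             /tau [H d c]H_sym.
rewrite !lorentz_alpha !tauJ; have := H_gauss u v w z; lra.
Qed.

Lemma alpha_linear u : linear (alpha u).
Proof.
move=> k v w; rewrite /alpha /tau H_linear !mulmxDl -!scalemxAl.
by rewrite opprD addrACA scalerBr.
Qed.

(** The complexified second fundamental form; the neutral form [split_lorentz]
    turns the [J]-invariance of the curvature into flatness. *)
Definition kaehler_flat_form u v : 'rV[R]_(N.+1 + N.+1) :=
  row_mx (alpha u v) (alpha u (J v)).

Definition split_lorentz (x y : 'rV[R]_(N.+1 + N.+1)) : R :=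
  lorentz (lsubmx x) (lsubmx y) - lorentz (rsubmx x) (rsubmx y).

Lemma split_lorentz_row_mx a b c d :
  split_lorentz (row_mx a b) (row_mx c d) = lorentz a c - lorentz b d.
Proof. by rewrite /split_lorentz !row_mxKl !row_mxKr. Qed.

Lemma kaehler_flat_form_linear u : linear (kaehler_flat_form u).
Proof.
move=> k v w; rewrite /kaehler_flat_form mul_i_linear !alpha_linear.
by rewrite scale_row_mx add_row_mx.
Qed.

Lemma kaehler_flat_form_linear_l v : linear (kaehler_flat_form^~ v).
Proof.
move=> k u w; rewrite /kaehler_flat_form ![alpha _ v]alphaC ![alpha _ (J v)]alphaC.
by rewrite !alpha_linear scale_row_mx add_row_mx.
Qed.

Lemma kaehler_flat_formP x y z t :
  split_lorentz (kaehler_flat_form x y) (kaehler_flat_form z t) =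
  split_lorentz (kaehler_flat_form x t) (kaehler_flat_form z y).
Proof.
rewrite !split_lorentz_row_mx.
have := alpha_gauss x y t z; rewrite [alpha t z]alphaC [alpha t x]alphaC.
rewrite [alpha (J t) z]alphaC [alpha (J t) x]alphaC.
rewrite [lorentz (alpha z y) _]lorentzC [lorentz (alpha z (J y)) _]lorentzC.
lra.
Qed.

(** Write [a], [b], [c] for [alpha] on [(z, z)], [(z, J z)], [(J z, J z)], where
    [z] and hence [J z] lie in the kernel of [kaehler_flat_form x] for the [x]
    of [flat_form_null].  The null relations used are
    [<a, a> = <b, b> = <c, c>] and [<a, c> = - <b, b>]; they make [a + c]
    isotropic. *)
Lemma kaehler_null_vector : (N.+1 < 3 * n)%N ->
  exists2 z, z != 0 & let v := alpha z z + alpha (J z) (J z) in lorentz v v = 0.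
Proof.
move=> lt_N.
have [|x null] := @flat_form_null _ _ _ kaehler_flat_form split_lorentz
  kaehler_flat_form_linear kaehler_flat_form_linear_l _ kaehler_flat_formP.
  move=> w; rewrite /split_lorentz [lsubmx 0]linear0 [rsubmx 0]linear0.
  by rewrite !lorentz0l subrr.
have [||z z0 xz] := @linear_ker_neq0 _ _ _ _ (kaehler_flat_form x)
  (block_mx (pair_tangent P) 0 0 (pair_tangent P)) (kaehler_flat_form_linear x).
- move=> y; rewrite /kaehler_flat_form mul_row_block !mulmx0 addr0 add0r.
  by rewrite !normal_part_pair_tangent // row_mx0.
- by rewrite rank_block_pair_tangent //; lia.
have alphaN u : {morph alpha u : v / - v} := linear_opp (alpha_linear u).
have xJz : kaehler_flat_form x (J z) = 0.
  move/eqP: xz; rewrite -row_mx0 => /eqP/eq_row_mx[xz xJz].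
  by rewrite /kaehler_flat_form mul_iK alphaN xz xJz oppr0 row_mx0.
exists z => //=.
have := null z z z z xz xz; have := null (J z) z (J z) z xz xz.
have := null z z (J z) (J z) xz xJz.
rewrite !split_lorentz_row_mx mul_iK alphaN lorentzNr lorentz_sqrD.
rewrite [alpha (J z) z]alphaC.
lra.
Qed.

Hypothesis f_hyperboloid : lorentz f f = -1.
Hypothesis f_future : 0 < f 0 0.
Hypothesis P_normal : forall u, lorentz f (u *m P) = 0.
Hypothesis H_position : forall u v,
  lorentz (H u v) f = - lorentz (u *m P) (v *m P).
Hypothesis P_height : forall u : T, (u *m P) 0 0 = 0.
Hypothesis H_height : forall u, H u u 0 0 <= 0.

(** The isotropic vector of [kaehler_null_vector] is in the closed past cone by
    maximality of the height, while its product with the future vector [f] is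
    [- 2 * lorentz (z *m P) (z *m P)], which is negative. *)
Lemma pointwise_dim_bound : (3 * n <= N.+1)%N.
Proof.
rewrite leqNgt; apply/negP => /kaehler_null_vector[z z0 /= null].
have alpha_f u v : lorentz (alpha u v) f = - lorentz (u *m P) (v *m P).
  by rewrite /alpha lorentzBl H_position [lorentz (_ *m P) f]lorentzC P_normal subr0.
have alpha_height u : alpha u u 0 0 <= 0.
  by rewrite /alpha mxE [X in _ + X]mxE P_height subr0.
have := past_null_lorentz_ge0 null _ f_hyperboloid f_future.
rewrite lorentzDl !alpha_f P_hermitian mxE => ge0.
have := P_pos z0; suff /ge0 : alpha z z 0 0 + alpha (J z) (J z) 0 0 <= 0 by lra.
by rewrite (le_trans (lerD (alpha_height z) (alpha_height (J z)))) ?addr0.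
Qed.

End PointwiseObstruction.

(** * Mixed derivatives and the second derivative test *)

Lemma is_derive_translate (R : realType) (V W : normedModType R) (f : V -> W)
    (w z v : V) :
  derivable f (z + w) v ->
  is_derive z v (fun y => f (y + w)) ('D_v f (z + w)).
Proof.
have E : (fun h : R => h^-1 *: (((fun y => f (y + w)) \o shift z) (h *: v)
             - f (z + w))) =
         (fun h => h^-1 *: ((f \o shift (z + w)) (h *: v) - f (z + w))).
  by apply/funext => h /=; rewrite addrA.
by move=> dfv; split; rewrite /derivable /derive E.
Qed.

Lemma is_derive_path (R : realType) (V W : normedModType R) (f : V -> W)
    (y v : V) (t : R) :
  derivable f (y + t *: v) v ->
  is_derive t 1 (fun s : R => f (y + s *: v)) ('D_v f (y + t *: v)).
Proof.
have E : (fun h : R => h^-1 *: (((fun s : R => f (y + s *: v)) \o shift t) (h *: 1)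
             - f (y + t *: v))) =
         (fun h => h^-1 *: ((f \o shift (y + t *: v)) (h *: v) - f (y + t *: v))).
  apply/funext => h /=; rewrite [h *: 1]mulr1 scalerDl.
  by rewrite addrCA.
by move=> dfv; split; rewrite /derivable /derive E.
Qed.

Section ScalarFunctions.
Context (R : realType) (V : normedModType R).
Implicit Types (f : V -> R) (x y u v : V).

Lemma path_MVT f df y v (h : R) : 0 < h ->
  (forall t, 0 <= t <= h -> is_derive (y + t *: v) v f (df (y + t *: v))) ->
  exists2 c, 0 < c < h & f (y + h *: v) - f y = df (y + c *: v) * h.
Proof.
move=> h0 f_df.
have f_path t : 0 <= t <= h ->
    is_derive t 1 (fun s : R => f (y + s *: v)) (df (y + t *: v)).
  by move=> /f_df[d <-]; exact: is_derive_path.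
have [||c] := @MVT R (fun t => f (y + t *: v)) (fun t => df (y + t *: v)) 0 h h0.
- move=> t; rewrite in_itv /= => /andP[t0 th].
  by apply: f_path; rewrite !ltW.
- apply: derivable_within_continuous => t; rewrite in_itv /= => /f_path.
  by case.
- by rewrite in_itv /= scale0r addr0 subr0 => c0h E; exists c.
Qed.

(** The mean value theorem is applied first to the difference of [f] between the
    two sides of the parallelogram in the direction [u], then to [fu] in the
    direction [v]. *)
Lemma second_difference_MVT f fu fuv x u v (h : R) : 0 < h ->
  (forall s t, 0 <= s <= h -> 0 <= t <= h -> let y := x + s *: u + t *: v in
    is_derive y u f (fu y) /\ is_derive y v fu (fuv y)) ->
  exists s t, [/\ 0 < s < h, 0 < t < h &
    f (x + h *: u + h *: v) - f (x + h *: u) - (f (x + h *: v) - f x) =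
    fuv (x + s *: u + t *: v) * h * h].
Proof.
move=> h0 df; have hh : 0 <= h <= h by rewrite lexx ltW.
have h00 : 0 <= (0 : R) <= h by rewrite lexx ltW.
pose g z := f (z + h *: v) - f z; pose dg z := fu (z + h *: v) - fu z.
have g_dg s : 0 <= s <= h -> is_derive (x + s *: u) u g (dg (x + s *: u)).
  move=> sh; have [[d1 E1] _] := df s h sh hh; have [i0 _] := df s 0 sh h00.
  rewrite scale0r addr0 in i0; have := is_derive_translate d1; rewrite E1 => i1.
  exact: is_deriveB.
have [s sh Es] := path_MVT h0 g_dg.
have shw : 0 <= s <= h by case/andP: sh => ? ?; rewrite !ltW.
have [|t th Et] := @path_MVT fu fuv (x + s *: u) v h h0.
  by move=> t th; have [] := df s t shw th.
by exists s, t; split=> //; rewrite -Et -Es.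
Qed.

(** Schwarz's theorem: the second difference of [f] on a small parallelogram is
    symmetric in [u] and [v], and equals both [fuv] and [fvu] at nearby points,
    up to the same factor. *)
Lemma mixed_derive_comm f fu fv fuv fvu x u v :
  (\forall y \near x,
     [/\ is_derive y u f (fu y), is_derive y v f (fv y),
         is_derive y v fu (fuv y) & is_derive y u fv (fvu y)]) ->
  {for x, continuous fuv} -> {for x, continuous fvu} -> fuv x = fvu x.
Proof.
move=> df cuv cvu.
apply/eqP; rewrite -subr_eq0 -normr_le0; apply/ler_addgt0Pl => e e0.
rewrite addr0.
have e20 : 0 < e / 2 by rewrite divr_gt0.
have /nbhs_ballP[r /= r0 ball_r] : \forall y \near x,
   [/\ [/\ is_derive y u f (fu y), is_derive y v f (fv y),
         is_derive y v fu (fuv y) & is_derive y u fv (fvu y)],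
   `|fuv x - fuv y| < e / 2 & `|fvu x - fvu y| < e / 2].
  move/cvgrPdist_lt/(_ _ e20): cvu => cvu.
  move/cvgrPdist_lt/(_ _ e20): cuv => cuv.
  by apply: filterS3 df cuv cvu => y.
(* The parallelogram of sides [h *: u] and [h *: v] stays in the ball. *)
pose h := r / 2 / (`|u| + `|v| + 1).
have D0 : 0 < `|u| + `|v| + 1 by rewrite ltr_wpDl // addr_ge0.
have h0 : 0 < h by rewrite !divr_gt0.
have in_ball s t : 0 <= s <= h -> 0 <= t <= h -> ball x r (x + s *: u + t *: v).
  move=> /andP[s0 sh] /andP[t0 th]; rewrite -ball_normE /ball_ /=.
  rewrite -addrA opprD addNKr normrN.
  apply: (@le_lt_trans _ _ (h * (`|u| + `|v| + 1))); last first.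
    by rewrite /h divfK ?gt_eqF //; lra.
  apply: le_trans (ler_normD _ _) _; rewrite !normrZ !ger0_norm //.
  have := normr_ge0 u; have := normr_ge0 v; nra.
have [|s [t [sh th E1]]] := @second_difference_MVT f fu fuv x u v h h0.
  by move=> s t sh th; case: (ball_r _ (in_ball s t sh th)) => -[].
have [|t' [s' [th' sh' E2]]] := @second_difference_MVT f fv fvu x v u h h0.
  move=> s' t' sh' th'; rewrite addrAC.
  by case: (ball_r _ (in_ball t' s' th' sh')) => -[].
have lew a : 0 < a < h -> 0 <= a <= h by case/andP => ? ?; rewrite !ltW.
have [_ B1 _] := ball_r _ (in_ball s t (lew _ sh) (lew _ th)).
have [_ _ B2] := ball_r _ (in_ball s' t' (lew _ sh') (lew _ th')).
have EE : fuv (x + s *: u + t *: v) = fvu (x + s' *: u + t' *: v).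
  apply: (mulIf (lt0r_neq0 h0)); apply: (mulIf (lt0r_neq0 h0)).
  rewrite -E1 [x + s' *: u + _]addrAC -E2 [x + h *: v + _]addrAC.
  by rewrite opprB addrACA opprB; ring.
rewrite EE in B1.
rewrite -(subrKA (fvu (x + s' *: u + t' *: v))).
rewrite (le_trans (ler_normD _ _)) // (splitr e) lerD ?ltW //.
by rewrite distrC.
Qed.

Lemma derive_gt0_pos f x u : derivable f x u -> f x = 0 -> 0 < 'D_u f x ->
  exists2 d : R, 0 < d & forall h, 0 < h < d -> 0 < f (x + h *: u).
Proof.
move=> df fx0 D0; move: (df) => /cvgr_gt/(_ _ D0)[d /= d0 gt0].
exists d => // h /andP[h0 hd]; have /= := gt0 h.
rewrite fx0 subr0 /ball_ /= sub0r normrN gtr0_norm // => /(_ hd).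
by rewrite gt_eqF // => /(_ isT); rewrite addrC pmulr_rgt0 ?invr_gt0.
Qed.

(** If the second derivative were positive, the first one, which vanishes at [x],
    would be positive just after [x], and [f] would increase there. *)
Lemma derive2_at_max f x u :
  (\forall y \near x, derivable f y u) -> derivable ('D_u f) x u ->
  (\forall y \near x, f y <= f x) ->
  'D_u f x = 0 /\ 'D_u ('D_u f) x <= 0.
Proof.
move=> df ddf fmax.
have /nbhs_ballP[r /= r0 ball_r] : \forall y \near x, derivable f y u /\ f y <= f x.
  by apply: filterS2 df fmax.
pose h := r / (`|u| + 1).
have D0 : 0 < `|u| + 1 by rewrite ltr_wpDl.
have h0 : 0 < h by rewrite divr_gt0.
have in_ball s : `|s| < h -> ball x r (x + s *: u).
  move=> sh; rewrite -ball_normE /ball_ /= opprD addNKr normrN normrZ.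
  apply: (@le_lt_trans _ _ (`|s| * (`|u| + 1))).
    by rewrite ler_wpM2l ?lerDl.
  by rewrite -ltr_pdivlMr.
have Du0 : 'D_u f x = 0.
  have [|_] := @is_derive_path _ _ _ f x u 0; rewrite scale0r addr0.
    exact: (proj1 (ball_r x (ballxx x r0))).
  move=> <-.
  have in_h t : t \in `]- h, h[ -> ball x r (x + t *: u).
    by rewrite in_itv /= -ltr_norml; exact: in_ball.
  apply: derive_val; apply: (@derive1_at_max _ _ (- h) h).
  - by rewrite ge0_cp // ltW.
  - by move=> t /in_h/ball_r[df_t _]; case: (is_derive_path df_t).
  - by rewrite in_itv /= oppr_lt0 h0.
  - by move=> t /in_h/ball_r[_]; rewrite scale0r addr0.
split=> //; rewrite leNgt; apply/negP => /(derive_gt0_pos ddf Du0)[d d0 gt0].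
pose k := Num.min d h / 2.
have [k0 kd kh] : [/\ 0 < k, k < d & k < h].
  have m0 : 0 < Num.min d h by rewrite lt_min d0.
  have : Num.min d h <= d by rewrite ge_min lexx.
  have : Num.min d h <= h by rewrite ge_min lexx orbT.
  by rewrite /k; split; lra.
have [|c /andP[c0 ck]] := @path_MVT f ('D_u f) x u k k0.
  move=> t /andP[t0 tk]; apply/derivableP/(proj1 (ball_r _ _)); apply: in_ball.
  by rewrite ger0_norm // (le_lt_trans tk).
have := proj2 (ball_r _ (in_ball k _)); rewrite gtr0_norm // => /(_ kh).
have : 0 < 'D_u f (x + c *: u) by apply: gt0; rewrite c0 (lt_trans ck).
move=> Dc le E; have : 0 < 'D_u f (x + c *: u) * k by rewrite mulr_gt0.
by rewrite -E subr_gt0 ltNge le.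
Qed.

End ScalarFunctions.

(** * Smooth vector-valued maps *)

Lemma is_derive_coord (R : realType) (V : normedModType R) k
    (F : V -> 'rV[R]_k) (dF : 'rV[R]_k) x v (j : 'I_k) :
  is_derive x v F dF -> is_derive x v (fun y => F y 0 j) (dF 0 j).
Proof.
by case=> dFx <-; split; [exact: (derivable_mxP F x v).1|rewrite derive_mx ?mxE].
Qed.

Lemma is_derive_lorentz (R : realType) (V : normedModType R) N
    (a b : V -> 'rV[R]_N.+1) (da db : 'rV[R]_N.+1) x v :
  is_derive x v a da -> is_derive x v b db ->
  is_derive x v (fun y => lorentz (a y) (b y))
    (lorentz da (b x) + lorentz (a x) db).
Proof.
move=> a_da b_db.
have prod j : is_derive x v (fun y => a y 0 j * b y 0 j)
    (da 0 j * b x 0 j + a x 0 j * db 0 j).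
  have := is_deriveM (is_derive_coord j a_da) (is_derive_coord j b_db).
  by move/is_derive_eq; apply; rewrite /GRing.scale /= addrC mulrC.
have sum := is_derive_sum (fun j : 'I_N => prod (lift ord0 j)).
have := is_deriveD (is_deriveN (prod 0)) sum.
have -> : - (fun y => a y 0 0 * b y 0 0) +
   \sum_(j < N) (fun y => a y 0 (lift ord0 j) * b y 0 (lift ord0 j)) =
   (fun y => lorentz (a y) (b y)).
  by apply/funext => y; rewrite /lorentz !fctE fct_sumE.
move/is_derive_eq; apply.
by rewrite big_split /= opprD addrACA.
Qed.

Section SmoothOn.
Context (R : realType) (V W : normedModType R) (U : set V) (F : V -> W).
Hypothesis F_smooth : smooth_on U F.

Lemma smooth_on_derive v : smooth_on U ('D_v F).
Proof.
by move=> s y Uy; have := F_smooth (rcons s v) Uy; rewrite /iter_derive foldr_rcons.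
Qed.

Lemma smooth_is_derive x v : U x -> is_derive x v F ('D_v F x).
Proof. by move=> Ux; apply/derivableP/diff_derivable; exact: (F_smooth [::]). Qed.

Lemma smooth_derive_linear x : U x -> linear (fun v => 'D_v F x).
Proof.
move=> Ux k u v; have dF : differentiable F x by exact: (F_smooth [::]).
by rewrite !deriveE // linearP.
Qed.

Lemma smooth_continuous x : U x -> {for x, continuous F}.
Proof. by move=> Ux; apply: differentiable_continuous; exact: (F_smooth [::]). Qed.

End SmoothOn.

Lemma smooth_derive_comm (R : realType) (V : normedModType R) k (U : set V)
    (F : V -> 'rV[R]_k) x u v :
  open U -> smooth_on U F -> U x -> 'D_v ('D_u F) x = 'D_u ('D_v F) x.
Proof.
move=> U_open F_sm Ux; apply/rowP => j.
have coord_cont a b :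
    {for x, continuous (fun y => 'D_a ('D_b F) y 0 j)}.
  apply: (@continuous_comp _ _ _ ('D_a ('D_b F)) (fun M : 'rV[R]_k => M 0 j)).
    exact: smooth_continuous (smooth_on_derive (smooth_on_derive F_sm b) a) _ Ux.
  exact: coord_continuous.
apply: (@mixed_derive_comm _ _ (fun y => F y 0 j) (fun y => 'D_u F y 0 j)
  (fun y => 'D_v F y 0 j) (fun y => 'D_v ('D_u F) y 0 j)
  (fun y => 'D_u ('D_v F) y 0 j) x u v) => //.
near=> y; have Uy : U y by near: y; exact: open_nbhs_nbhs.
by split; apply: is_derive_coord; apply: (@smooth_is_derive _ _ _ U) => //;
  exact: smooth_on_derive.
Unshelve. all: by end_near. Qed.

Lemma open_eq_derive (R : realType) (V W : normedModType R) (U : set V)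
    (f g : V -> W) x v :
  open U -> U x -> (forall y, U y -> f y = g y) -> 'D_v f x = 'D_v g x.
Proof.
move=> U_open Ux fg; apply: near_eq_derive; near=> y; apply: fg.
by near: y; exact: open_nbhs_nbhs.
Unshelve. all: by end_near. Qed.

(** * Christoffel symbols and the Gauss equation of a Kaehler metric *)

(** Here [G u v w] is the Christoffel symbol of the first kind and [A u v w] the
    derivative along [u] of the metric on the constant fields [v] and [w].
    Koszul's formula
    [2 * G u v w = A u v w + A v u w - A w u v] reduces the claim to
    closedness of the Kaehler form on [(u, v, w)] minus the same on
    [(u, J v, J w)]. *)
Lemma kaehler_christoffel (R : realType) (T : zmodType) (J : T -> T)
    (A G : T -> T -> T -> R) :
  (forall u v w, G u v w = G v u w) ->
  (forall u v w, G u (J (J v)) w = - G u v w) ->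
  (forall u v w, G u v (J (J w)) = - G u v w) ->
  (forall u v w, A u v w = G u v w + G u w v) ->
  (forall u v w, A u (J v) (J w) = A u v w) ->
  (forall u v w, A u (J v) w + A v (J w) u + A w (J u) v = 0) ->
  forall u v w, G u (J v) w = - G u v (J w).
Proof.
move=> sym JJ2 JJ3 AE herm closed u v w.
have c1 := closed u v w; have c2 := closed u (J v) (J w).
have h1 := herm u (J v) w; have h2 := herm (J w) u v; have h3 := herm w (J u) v.
rewrite !AE ?JJ2 ?JJ3 in c1 c2 h1 h2 h3.
have s1 := sym u (J v) w; have s2 := sym u w (J v); have s3 := sym v (J w) u.
have s4 := sym v u (J w); have s5 := sym w (J u) v; have s6 := sym w v (J u).
have s7 := sym u (J w) v; have s8 := sym u v w; have s9 := sym u w v.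
have t1 := sym (J v) (J w) u; have t2 := sym (J v) w u; have t3 := sym (J u) (J w) v.
have t4 := sym (J u) v w; have t5 := sym (J u) (J v) w.
lra.
Qed.

(** [D1], [D2], [D3] are the derivatives of an immersion.  The hypothesis is the
    derivative of [ip (D2 a (J v)) (D1 (J w)) = ip (D2 a v) (D1 w)] in the
    direction [b]; exchanging [a] and [b] and subtracting removes the third
    derivatives. *)
Lemma antisymmetrized_gauss (R : realType) (T L : Type) (J : T -> T)
    (ip : L -> L -> R) (D1 : T -> L) (D2 : T -> T -> L) (D3 : T -> T -> T -> L) :
  (forall u v, D2 u v = D2 v u) ->
  (forall u v w, D3 u v w = D3 v u w) ->
  (forall a b v w,
    ip (D3 b a (J v)) (D1 (J w)) + ip (D2 a (J v)) (D2 b (J w)) =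
    ip (D3 b a v) (D1 w) + ip (D2 a v) (D2 b w)) ->
  forall u v w z,
    ip (D2 u v) (D2 w z) - ip (D2 z v) (D2 w u) =
    ip (D2 u (J v)) (D2 (J w) z) - ip (D2 z (J v)) (D2 (J w) u).
Proof.
move=> D2C D3C deriv u v w z.
have := deriv u z v w; have := deriv z u v w.
rewrite !(D3C z u) !(D2C w) !(D2C (J w)); lra.
Qed.

(** An immersion [F] of an open subset of C^n, for which the induced metric is
    Kaehler.  The metric only appears through products of derivatives of [F]. *)
Section LocalImmersion.
Context (R : realType) (n N : nat).
Local Notation T := ('rV[R]_(n + n)).
Local Notation J := (@mul_i R n).
Context (U : set T) (F : T -> 'rV[R]_N.+1).
Hypothesis U_open : open U.
Hypothesis F_smooth : smooth_on U F.
Hypothesis F_hermitian : forall x u v, U x ->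
  lorentz ('D_(J u) F x) ('D_(J v) F x) = lorentz ('D_u F x) ('D_v F x).
Hypothesis F_closed : forall x u v w, U x ->
  'D_u (fun y => lorentz ('D_(J v) F y) ('D_w F y)) x +
  'D_v (fun y => lorentz ('D_(J w) F y) ('D_u F y)) x +
  'D_w (fun y => lorentz ('D_(J u) F y) ('D_v F y)) x = 0.

Let F1_smooth v : smooth_on U ('D_v F) := smooth_on_derive F_smooth v.
Let F2_smooth u v : smooth_on U ('D_u ('D_v F)) := smooth_on_derive (F1_smooth v) u.

Lemma derive2C x u v : U x -> 'D_u ('D_v F) x = 'D_v ('D_u F) x.
Proof. by move=> Ux; exact: (smooth_derive_comm _ _ U_open F_smooth). Qed.

Lemma derive2_linear x u : U x -> linear (fun v => 'D_u ('D_v F) x).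
Proof.
move=> Ux; apply: (@sym_linear _ _ _ (fun u v => 'D_u ('D_v F) x)) => [a b|v].
  exact: derive2C.
exact: (smooth_derive_linear (F1_smooth v)).
Qed.

Lemma derive_mul_i2 x u : U x -> 'D_(J (J u)) F x = - 'D_u F x.
Proof.
by move=> Ux; rewrite mul_iK; exact: linear_opp (smooth_derive_linear F_smooth Ux) u.
Qed.

Lemma derive2_mul_i2 x u v : U x -> 'D_u ('D_(J (J v)) F) x = - 'D_u ('D_v F) x.
Proof.
by move=> Ux; rewrite mul_iK; exact: linear_opp (derive2_linear u Ux) v.
Qed.

Lemma derive_metric x u v w : U x ->
  'D_u (fun y => lorentz ('D_v F y) ('D_w F y)) x =
  lorentz ('D_u ('D_v F) x) ('D_w F x) + lorentz ('D_u ('D_w F) x) ('D_v F x).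
Proof.
move=> Ux; rewrite [X in _ + X]lorentzC.
by apply: derive_val; apply: is_derive_lorentz; exact: (@smooth_is_derive _ _ _ U).
Qed.

Lemma christoffel_mul_i x u v w : U x ->
  lorentz ('D_u ('D_(J v) F) x) ('D_w F x) =
  - lorentz ('D_u ('D_v F) x) ('D_(J w) F x).
Proof.
move=> Ux.
apply: (@kaehler_christoffel R T J
  (fun u v w => 'D_u (fun y => lorentz ('D_v F y) ('D_w F y)) x)
  (fun u v w => lorentz ('D_u ('D_v F) x) ('D_w F x))) => {u v w} u v w.
- by rewrite (derive2C u v Ux).
- by rewrite derive2_mul_i2 // lorentzNl.
- by rewrite derive_mul_i2 // lorentzNr.
- exact: derive_metric.
- by apply: (open_eq_derive _ U_open Ux) => y; exact: F_hermitian.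
- exact: F_closed.
Qed.

(** This form of [christoffel_mul_i] holds identically on [U] and relates only
    products of derivatives of [F], so it can be differentiated again. *)
Lemma christoffel_hermitian x u v w : U x ->
  lorentz ('D_u ('D_(J v) F) x) ('D_(J w) F x) =
  lorentz ('D_u ('D_v F) x) ('D_w F x).
Proof.
move=> Ux; apply: etrans (christoffel_mul_i u v (J w) Ux) _.
by rewrite derive_mul_i2 // lorentzNr opprK.
Qed.

Lemma derive2_gauss x u v w z : U x ->
  let H u v := 'D_u ('D_v F) x in
  lorentz (H u v) (H w z) - lorentz (H z v) (H w u) =
  lorentz (H u (J v)) (H (J w) z) - lorentz (H z (J v)) (H (J w) u).
Proof.
move=> Ux; apply: (@antisymmetrized_gauss R T _ J (@lorentz R N)
  (fun u => 'D_u F x) (fun u v => 'D_u ('D_v F) x)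
  (fun u v w => 'D_u ('D_v ('D_w F)) x)) => {u v w z} [u v|u v w|a b v w].
- exact: derive2C.
- exact: (smooth_derive_comm _ _ U_open (F1_smooth w)).
have deriv c d : 'D_b (fun y => lorentz ('D_a ('D_c F) y) ('D_d F y)) x =
    lorentz ('D_b ('D_a ('D_c F)) x) ('D_d F x) +
    lorentz ('D_a ('D_c F) x) ('D_b ('D_d F) x).
  by apply: derive_val; apply: is_derive_lorentz; exact: (@smooth_is_derive _ _ _ U).
apply: etrans (esym (deriv _ _)) (etrans _ (deriv _ _)).
by apply: (open_eq_derive _ U_open Ux) => y; exact: christoffel_hermitian.
Qed.

Hypothesis F_pos : forall x u, U x -> u != 0 -> 0 < lorentz ('D_u F x) ('D_u F x).
Hypothesis F_hyperboloid : forall x, U x -> lorentz (F x) (F x) = -1.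

Lemma position_normal x u : U x -> lorentz (F x) ('D_u F x) = 0.
Proof.
move=> Ux.
have := is_derive_lorentz (smooth_is_derive F_smooth u Ux) (smooth_is_derive F_smooth u Ux).
move/(@derive_val _ _ _ _ _ _ _); rewrite (open_eq_derive _ U_open Ux F_hyperboloid).
rewrite derive_cst lorentzC; lra.
Qed.

Lemma position_derive2 x u v : U x ->
  lorentz ('D_u ('D_v F) x) (F x) = - lorentz ('D_u F x) ('D_v F x).
Proof.
move=> Ux.
have := is_derive_lorentz (smooth_is_derive F_smooth u Ux) (smooth_is_derive (F1_smooth v) u Ux).
move/(@derive_val _ _ _ _ _ _ _).
rewrite (@open_eq_derive _ _ _ U _ (cst 0) x u U_open Ux); last first.
  by move=> y; exact: position_normal.
rewrite derive_cst (lorentzC (F x)); lra.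
Qed.

Lemma height_at_max x u : U x -> (forall y, U y -> F y 0 0 <= F x 0 0) ->
  'D_u F x 0 0 = 0 /\ 'D_u ('D_u F) x 0 0 <= 0.
Proof.
move=> Ux F_max; have near_U : \forall y \near x, U y by exact: open_nbhs_nbhs.
have D1 y : U y -> is_derive y u (fun y => F y 0 0) ('D_u F y 0 0).
  by move=> Uy; apply: is_derive_coord; exact: (smooth_is_derive F_smooth).
have D2 : is_derive x u (fun y => 'D_u F y 0 0) ('D_u ('D_u F) x 0 0).
  by apply: is_derive_coord; exact: (smooth_is_derive (F1_smooth u)).
have near_eq : \forall y \near x, 'D_u F y 0 0 = 'D_u (fun y => F y 0 0) y.
  by apply: filterS near_U => y /D1[_ ->].
have [d E2] := near_eq_is_derive near_eq D2; rewrite -E2.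
have [_ <-] := D1 x Ux.
apply: derive2_at_max => //.
- by apply: filterS near_U => y /D1[].
- by apply: filterS near_U => y; exact: F_max.
Qed.

Lemma height_max_dim_bound x : U x -> 0 < F x 0 0 ->
  (forall y, U y -> F y 0 0 <= F x 0 0) -> (3 * n <= N.+1)%N.
Proof.
move=> Ux F_future F_max.
have [P PE] := linear_mx (smooth_derive_linear F_smooth Ux).
apply: (@pointwise_dim_bound R n N P (fun u v => 'D_u ('D_v F) x) (F x)).
- by move=> u; rewrite PE; exact: F_pos.
- by move=> u v; rewrite !PE; exact: F_hermitian.
- by move=> u; exact: derive2_linear.
- by move=> u v; exact: derive2C.
- by move=> u v w; rewrite !PE; exact: christoffel_mul_i.
- by move=> u v w z; exact: derive2_gauss.
- exact: F_hyperboloid.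
- exact: F_future.
- by move=> u; rewrite PE; exact: position_normal.
- by move=> u v; rewrite !PE; exact: position_derive2.
- by move=> u; rewrite PE; case: (height_at_max u Ux F_max).
- by move=> u; case: (height_at_max u Ux F_max).
Qed.

End LocalImmersion.

(** * Compact Kaehler manifolds *)

Lemma isometric_immersion_continuous (R : realType) (n N : nat)
    (M : kaehlerManifold R n) (f : M -> 'rV[R]_N.+1) :
  isometric_immersion f -> continuous f.
Proof.
move=> [_ f_chart] p; have [i pi] := cmfd_cover p.
have [F_smooth _] := f_chart i.
have map_cont : {for p, continuous (chart_map (cmfd_chart i))}.
  have := @chart_map_continuous _ _ _ (cmfd_chart i).
  by rewrite continuous_open_subspace ?inE; [apply; rewrite inE|exact: chart_dom_open].
have F_cont : {for chart_map (cmfd_chart i) p, continuous (f \o chart_inv (cmfd_chart i))}.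
  apply: (smooth_continuous F_smooth).
  by exists p.
have near_f : {near p, f \o chart_inv (cmfd_chart i) \o chart_map (cmfd_chart i) =1 f}.
  have : nbhs p (chart_dom (cmfd_chart i)).
    by apply: open_nbhs_nbhs; split => //; exact: chart_dom_open.
  by apply: filterS => q qi /=; rewrite chart_mapK.
have : (f \o chart_inv (cmfd_chart i) \o chart_map (cmfd_chart i)) q @[q --> p]
    --> f (chart_inv (cmfd_chart i) (chart_map (cmfd_chart i) p)).
  exact: continuous_comp map_cont F_cont.
rewrite chart_mapK //; apply: cvg_trans; apply: near_eq_cvg.
by apply: filterS near_f => q /esym.
Qed.

(** The height [f q 0 0] attains its maximum over the whole of [M], so in any
    chart around a maximum point it is maximal on the whole chart domain.  For
    [N = 2 * n + p] the bound says that [n <= p + 1]. *)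
Lemma compact_kaehler_dim_bound (R : realType) (n N : nat)
    (M : kaehlerManifold R n) (f : M -> 'rV[R]_N.+1) :
  compact [set: M] -> [set: M] !=set0 -> isometric_immersion f ->
  (3 * n <= N.+1)%N.
Proof.
move=> M_compact M_neq0 f_iso; have [f_hyp f_chart] := f_iso.
have height_cont : {within [set: M], continuous (fun q => f q 0 0)}.
  apply: continuous_subspaceT => q.
  apply: (@continuous_comp _ _ _ f (fun v : 'rV[R]_N.+1 => v 0 0)).
    exact: isometric_immersion_continuous.
  exact: coord_continuous.
have [q _ q_max] := compact_EVT_max M_neq0 M_compact height_cont.
have [i qi] := cmfd_cover q.
set c := cmfd_chart i in qi.
have [F_smooth F_iso] := f_chart i.
have U_open : open (chart_cod c) by exact: chart_cod_open.
have metricE x u v : chart_cod c x ->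
    lorentz ('D_u (f \o chart_inv c) x) ('D_v (f \o chart_inv c) x) =
    bilin (kmetric i x) u v.
  by move=> /F_iso[_]; apply.
have Uq : chart_cod c (chart_map c q) by exists q.
have qK : chart_inv c (chart_map c q) = q by exact: chart_mapK.
apply: (@height_max_dim_bound R n N (chart_cod c) (f \o chart_inv c)
  U_open F_smooth _ _ _ _ (chart_map c q) Uq).
- by move=> x u v Ux; rewrite !metricE //; exact: kmetric_hermitian.
- move=> x u v w Ux; have := kmetric_closed Ux u v w.
  have E a b d : 'D_a (fun y => bilin (kmetric i y) (mul_i b) d) x =
      'D_a (fun y => lorentz ('D_(mul_i b) (f \o chart_inv c) y)
                             ('D_d (f \o chart_inv c) y)) x.
    by apply: (open_eq_derive _ U_open Ux) => y Uy; rewrite metricE.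
  by rewrite !E.
- by move=> x u Ux u0; rewrite metricE //; exact: kmetric_pos.
- by move=> x Ux; have [] := f_hyp (chart_inv c x).
- by have [] := f_hyp (chart_inv c (chart_map c q)).
- by move=> y _; rewrite /= qK; apply: q_max; rewrite inE.
Qed.

Local Close Scope ring_scope.

Theorem corollary5 (R : realType) (n p : nat) (M : kaehlerManifold R n)
  (hM : compact [set: M]) (hM0 : [set: M] !=set0)
  (hn : (3 <= n)%N) (hp : (p <= n - 2)%N) :
  ~ exists f : M -> 'rV[R]_(2 * n + p).+1,
      isometric_immersion f.
Proof.
by move=> [f /(compact_kaehler_dim_bound hM hM0)]; lia.
Qed.
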